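(* Let $R$ be a ring in which $2$ is a unit, and assume $\operatorname{rank}(\mathbf{V})\geq 3$. Let $\tau\in\mathbf{M}_{\mathrm{stab}}(R)$ and $a\in\mathbf{G}(R)$. Suppose that $\mathbf{X}_{\tau,a}=\mathbf{H}_{\tau_H}$ as schemes over $R$, i.e. $\mathbf{X}_{\tau,a}(R')=\mathbf{H}_{\tau_H}(R')$ for every $R$-algebra $R'$. Then $a\in\mathbf{H}(R)\mathbf{Z}(R)$.
   Context: Rings are commutative with $1$. Let $\mathbf{V}$ be a free $\mathbb{Z}$-module of finite rank and $\mathbf{V}^*=\mathrm{Hom}(\mathbf{V},\mathbb{Z})$. Fix $e\in\mathbf{V}$, $e^*\in\mathbf{V}^*$ with $e^*(e)=1$. For a ring $R$ put $\mathbf{V}(R)=\mathbf{V}\otimes R$, $\mathbf{V}^*(R)=\mathbf{V}^*\otimes R=\mathrm{Hom}_R(\mathbf{V}(R),R)$, $\mathbf{M}(R)=\mathrm{End}_R(\mathbf{V}(R))$, $\mathbf{G}(R)=\mathrm{Aut}_R(\mathbf{V}(R))$, $\mathbf{Z}(R)=R^\times\subseteq\mathbf{G}(R)$ (scalar operators). Juxtaposition denotes the natural operations: $\ell v=\ell(v)$, $xv=x(v)$, $\ell x=\ell\circ x$, and $v\ell\in\mathbf{M}(R)$ is $u\mapsto \ell(u)v$. Let $\mathbf{V}_H(R)=\{v: e^*v=0\}$, so $\mathbf{V}(R)=\mathbf{V}_H(R)\oplus Re$, and $1_H=1-ee^*$. Let $\mathbf{M}_H(R)=\mathrm{End}_R(\mathbf{V}_H(R))$,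 viewed inside $\mathbf{M}(R)$ by extending by $0$ on $Re$, and $\mathbf{H}(R)=\mathrm{Aut}_R(\mathbf{V}_H(R))$, viewed inside $\mathbf{G}(R)$ by acting trivially on $Re$ (so $\mathbf{H}(R)=\{g\in\mathbf{G}(R): ge=e,\ e^*g=e^*\}$). For $\tau\in\mathbf{M}(R)$ put $\tau_H=1_H\tau 1_H\in\mathbf{M}_H(R)$. For an $R$-algebra $R'$, $\mathbf{G}_\tau(R')$ is the centralizer of $\tau$ in $\mathbf{G}(R')$, and for $\sigma\in\mathbf{M}_H(R)$, $\mathbf{H}_\sigma(R')$ is the centralizer of $\sigma$ in $\mathbf{H}(R')$. A vector $v\in\mathbf{V}(R)$ is $\tau$-cyclic if $R[\tau]v=\mathbf{V}(R)$; $\ell\in\mathbf{V}^*(R)$ is $\tau$-cyclic if $\ell R[\tau]=\mathbf{V}^*(R)$. $\tau$ is stable if $e$ and $e^*$ are both $\tau$-cyclic; $\mathbf{M}_{\mathrm{stab}}(R)$ denotes the set of stable elements. For $\tau\in\mathbf{M}_{\mathrm{stab}}(R)$, $a\in\mathbf{G}(R)$ and an $R$-algebra $R'$, set $\mathbf{X}_{\tau,a}(R')=\{y\in\mathbf{H}_{\tau_H}(R'): ay\in\mathbf{H}(R')\mathbf{G}_\tau(R')\}$. *)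

(* Defs.v *)
From HB Require Import structures.
From mathcomp Require Import all_boot all_order all_algebra.

Set Implicit Arguments.
Unset Strict Implicit.
Unset Printing Implicit Defensive.

Import GRing.Theory.
Local Open Scope ring_scope.

(* Rings are [comPzRingType]s, so the zero ring is allowed.  The free module V
   is Z^n: V(R) = 'cV[R]_n, V^*(R) = 'rV[R]_n and M(R) = 'M[R]_n, the natural
   operations, including (v, l) |-> v l, all being [*m].  An R-algebra R' is
   given by its structure morphism f : {rmorphism R -> R'}, and base change is
   [map_mx f]. *)

(* [GRing.unit] is not available: a [comPzRingType] has no chosen inverse. *)
Definition invertible (S : pzRingType) (x : S) : Prop :=
  exists y : S, x * y = 1 /\ y * x = 1.

Section OverRing.

Variables (n : nat) (e : 'cV[int]_n) (es : 'rV[int]_n) (R : comPzRingType).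

Definition vecR : 'cV[R]_n := map_mx intr e.
Definition covecR : 'rV[R]_n := map_mx intr es.

Definition inG (g : 'M[R]_n) : Prop := invertible g.

Definition inZ (z : 'M[R]_n) : Prop :=
  exists2 r : R, invertible r & z = r%:M.

(* Aut(V_H(R)), acting trivially on the line R e. *)
Definition inH (g : 'M[R]_n) : Prop :=
  [/\ inG g, g *m vecR = vecR & covecR *m g = covecR].

Definition proj_H : 'M[R]_n := 1%:M - vecR *m covecR.

(* tau_H, extended by 0 on R e. *)
Definition compress_H (tau : 'M[R]_n) : 'M[R]_n := proj_H *m tau *m proj_H.

Definition inG_cent (tau g : 'M[R]_n) : Prop := inG g /\ g *m tau = tau *m g.

Definition inH_cent (sigma h : 'M[R]_n) : Prop :=
  inH h /\ h *m sigma = sigma *m h.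

(* The set product A B inside M(R). *)
Definition in_mulset (A B : 'M[R]_n -> Prop) (x : 'M[R]_n) : Prop :=
  exists a b : 'M[R]_n, [/\ A a, B b & x = a *m b].

(* The subalgebra R[tau]; {poly R} and [horner_mx] need a nonzero ring. *)
Definition in_adjoin (tau x : 'M[R]_n) : Prop :=
  exists c : seq R, x = \sum_(i < size c) c`_i *: tau ^+ i.

Definition cyclic_vec (tau : 'M[R]_n) (v : 'cV[R]_n) : Prop :=
  forall u : 'cV[R]_n, exists2 x : 'M[R]_n, in_adjoin tau x & u = x *m v.

Definition cyclic_covec (tau : 'M[R]_n) (l : 'rV[R]_n) : Prop :=
  forall k : 'rV[R]_n, exists2 x : 'M[R]_n, in_adjoin tau x & k = l *m x.

Definition stable (tau : 'M[R]_n) : Prop :=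
  cyclic_vec tau vecR /\ cyclic_covec tau covecR.

End OverRing.

Section OverAlgebra.

Variables (n : nat) (e : 'cV[int]_n) (es : 'rV[int]_n).
Variables (R R' : comPzRingType) (f : {rmorphism R -> R'}).

Definition inH_tauH (tau : 'M[R]_n) (y : 'M[R']_n) : Prop :=
  inH_cent e es (map_mx f (compress_H e es tau)) y.

Definition inX (tau a : 'M[R]_n) (y : 'M[R']_n) : Prop :=
  inH_tauH tau y /\
  in_mulset (inH e es (R := R')) (inG_cent (map_mx f tau)) (map_mx f a *m y).

End OverAlgebra.

(* Main.v *)
(** The moments e^* tau^i e are invariant under conjugating tau by H, so the
    hypothesis gives, with l = e^* a and v = a^-1 e,
      l (y tau^i y^-1) v = e^* tau^i e     for all i and all y in H_{tau_H}(R').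
    Taking y = 1 + eps X over R' = R[eps]/(eps^3), X in R[tau_H], and comparing
    coefficients gives identities over R.  Write l = lam + s e^* and v = w + t e
    with lam in V_H^* and w in V_H.  For i = 1 they give s w = 0 and t lam = 0,
    because 2 is a unit, so f = lam w = 1 - s t is idempotent, and f = 0 would
    force lam = w = 0, which is the claim.  For i = 2 they say that, where f = 1,
    the functionals X |-> lam X b and X |-> c X w on R[tau_H] (b, c being the
    off-diagonal blocks of tau) are multiples of one algebra character, so w is
    an eigenvector of tau_H.  The moments at y = 1 then force f c to be a multiple of lam, hence f
    times the identity of V_H has rank at most one, and f = 0 as rank V_H >= 2. *)

Require Import Defs.
From HB Require Import structures.
From mathcomp Require Import all_boot all_order all_algebra.
From mathcomp Require Import ring.

Set Implicit Arguments.
Unset Strict Implicit.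
Unset Printing Implicit Defensive.

Import GRing.Theory.
Local Open Scope ring_scope.

(** * The test algebra of polynomials truncated at order three *)

Section Truncated.

Variable R : comPzRingType.

(* R[eps]/(eps^3); the triple (x0, x1, x2) is x0 + x1 eps + x2 eps^2. *)
Definition trunc3 : Type := R * R * R.

HB.instance Definition _ := GRing.Zmodule.copy trunc3 (R * R * R)%type.

Definition trunc3_one : trunc3 := (1, 0, 0).

Definition trunc3_mul (x y : trunc3) : trunc3 :=
  (x.1.1 * y.1.1, x.1.1 * y.1.2 + x.1.2 * y.1.1,
   x.1.1 * y.2 + x.1.2 * y.1.2 + x.2 * y.1.1).

Lemma trunc3_mulA : associative trunc3_mul.
Proof.
by move=> [[a b] c] [[a' b'] c'] [[a'' b''] c'']; congr (_, _, _) => /=; ring.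
Qed.

Lemma trunc3_mulC : commutative trunc3_mul.
Proof. by move=> [[a b] c] [[a' b'] c']; congr (_, _, _) => /=; ring. Qed.

Lemma trunc3_mul1 : left_id trunc3_one trunc3_mul.
Proof. by move=> [[a b] c]; congr (_, _, _) => /=; ring. Qed.

Lemma trunc3_mulDl : left_distributive trunc3_mul +%R.
Proof.
by move=> [[a b] c] [[a' b'] c'] [[a'' b''] c'']; congr (_, _, _) => /=; ring.
Qed.

HB.instance Definition _ := GRing.Zmodule_isComPzRing.Build trunc3
  trunc3_mulA trunc3_mulC trunc3_mul1 trunc3_mulDl.

Definition trunc3_const (x : R) : trunc3 := (x, 0, 0).

Lemma trunc3_const_zmod : zmod_morphism trunc3_const.
Proof. by move=> x y; congr (_, _, _) => /=; rewrite subrr. Qed.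

Lemma trunc3_const_monoid : monoid_morphism trunc3_const.
Proof. by split=> // x y; congr (_, _, _) => /=; ring. Qed.

HB.instance Definition _ :=
  GRing.isZmodMorphism.Build R trunc3 trunc3_const trunc3_const_zmod.
HB.instance Definition _ :=
  GRing.isMonoidMorphism.Build R trunc3 trunc3_const trunc3_const_monoid.

Definition trunc3_eps : trunc3 := (0, 1, 0).

Lemma trunc3_eps3 : trunc3_eps ^+ 3 = 0.
Proof. by rewrite !exprS expr0; congr (_, _, _) => /=; ring. Qed.

Lemma trunc3_coef (x y z x' : R) :
  trunc3_const x + trunc3_eps * trunc3_const y + trunc3_eps ^+ 2 * trunc3_const z
    = trunc3_const x' -> y = 0 /\ z = 0.
Proof.
rewrite expr2 => -[_ h1 h2]; split.
  by rewrite -[RHS]h1 /=; ring.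
by rewrite -[RHS]h2 /=; ring.
Qed.

End Truncated.

(* The right-hand side factors through R^2 and n > 2, so det (f%:M) = f ^+ n
   vanishes. *)
Lemma idem_rank1 (R : comPzRingType) (n : nat) (f : R) (u v : 'cV[R]_n)
    (k l : 'rV[R]_n) :
  (3 <= n)%N -> f * f = f -> f%:M = u *m k + v *m l -> f = 0.
Proof.
case: n u v k l => [|[|[|m]]] // u v k l _ ff E.
(* Both factors are padded with zeros to square matrices, so that the determinant is multiplicative;
   the left one has a zero column at index 2. *)
have Ef : f%:M = row_mx (row_mx u v) (0 : 'M_(_, m.+1))
    *m (col_mx (col_mx k l) 0 : 'M_(m.+3)).
  by rewrite mul_row_col mul0mx addr0 mul_row_col.
have := congr1 determinant Ef; rewrite det_scalar det_mulmx.
rewrite (expand_det_col (row_mx _ _) (rshift 2 ord0)) big1 ?mul0r; last first.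
  by move=> i _; rewrite row_mxEr mxE mul0r.
suff -> : forall j, f ^+ j.+1 = f by [].
by elim=> [|j IH]; rewrite ?expr1 // exprS IH.
Qed.

(** * Pairing covectors with vectors *)

Definition dot (R : pzRingType) (n : nat) (k : 'rV[R]_n) (v : 'cV[R]_n) : R :=
  (k *m v) 0 0.

Section Dot.

Variables (R : comPzRingType) (n : nat).
Implicit Types (k l : 'rV[R]_n) (u v : 'cV[R]_n).

Lemma dotE k v : k *m v = dot k v *: 1%:M.
Proof. by rewrite scalemx1; exact: mx11_scalar. Qed.

Lemma dot_eq0 k v : k *m v = 0 -> dot k v = 0.
Proof. by rewrite /dot => ->; rewrite mxE. Qed.

Lemma dotDl k l v : dot (k + l) v = dot k v + dot l v.
Proof. by rewrite /dot mulmxDl mxE. Qed.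

Lemma dotDr k u v : dot k (u + v) = dot k u + dot k v.
Proof. by rewrite /dot mulmxDr mxE. Qed.

Lemma dotZl x k v : dot (x *: k) v = x * dot k v.
Proof. by rewrite /dot -scalemxAl mxE. Qed.

Lemma dotZr x k v : dot k (x *: v) = x * dot k v.
Proof. by rewrite /dot -scalemxAr mxE. Qed.

Lemma dotNl k v : dot (- k) v = - dot k v.
Proof. by rewrite /dot mulNmx mxE. Qed.

Lemma dotNr k v : dot k (- v) = - dot k v.
Proof. by rewrite /dot mulmxN mxE. Qed.

Lemma dotA k (X : 'M[R]_n) v : dot (k *m X) v = dot k (X *m v).
Proof. by rewrite /dot mulmxA. Qed.

Lemma dot_col_eq0 v : (forall k, dot k v = 0) -> v = 0.
Proof.
by move=> h; apply/colP=> i; rewrite mxE -(h (delta_mx 0 i)) /dot -rowE mxE.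
Qed.

Lemma dot_row_eq0 k : (forall v, dot k v = 0) -> k = 0.
Proof.
by move=> h; apply/rowP=> i; rewrite mxE -(h (delta_mx i 0)) /dot -colE mxE.
Qed.

End Dot.

(** * Induction along cyclic vectors and covectors *)

Section Cyclic.

Variables (R : comPzRingType) (n : nat) (tau : 'M[R]_n).

(** Cyclicity makes the tau^i v span, so a linear property need only be tested on them. *)
Lemma cyclic_vec_ind (v : 'cV[R]_n) (Q : 'cV[R]_n -> Prop) :
  (forall u, exists2 x, in_adjoin tau x & u = x *m v) ->
  Q 0 -> (forall x u u', Q u -> Q u' -> Q (x *: u + u')) ->
  (forall i, Q (tau ^+ i *m v)) -> forall u, Q u.
Proof.
move=> cyc Q0 Qlin Qi u; have [x [s ->] ->] := cyc u.
rewrite mulmx_suml; elim/big_ind: _ => //.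
  by move=> u1 u2 h1 h2; rewrite -[u1]scale1r; apply: Qlin.
by move=> i _; rewrite -scalemxAl -[_ *: _]addr0; apply: Qlin.
Qed.

Lemma cyclic_covec_ind (l : 'rV[R]_n) (Q : 'rV[R]_n -> Prop) :
  (forall k, exists2 x, in_adjoin tau x & k = l *m x) ->
  Q 0 -> (forall x k k', Q k -> Q k' -> Q (x *: k + k')) ->
  (forall i, Q (l *m tau ^+ i)) -> forall k, Q k.
Proof.
move=> cyc Q0 Qlin Qi u; have [x [s ->] ->] := cyc u.
rewrite mulmx_sumr; elim/big_ind: _ => //.
  by move=> u1 u2 h1 h2; rewrite -[u1]scale1r; apply: Qlin.
by move=> i _; rewrite -scalemxAr -[_ *: _]addr0; apply: Qlin.
Qed.

End Cyclic.

(** * Block decomposition of tau and the bicommutant of T *)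

Section Blocks.

Variables (R : comPzRingType) (n : nat) (e : 'cV[R]_n) (es : 'rV[R]_n).
Variable tau : 'M[R]_n.
Hypothesis ese : es *m e = 1%:M.
Hypothesis cyc_e : forall u, exists2 x, in_adjoin tau x & u = x *m e.
Hypothesis cyc_es : forall k, exists2 x, in_adjoin tau x & k = es *m x.

(* The blocks of tau for V = V_H + R e, each extended by 0 to all of V. *)
Variables (P T : 'M[R]_n) (b : 'cV[R]_n) (c : 'rV[R]_n) (d : R).
Hypothesis PE : P = 1%:M - e *m es.
Hypotheses (Te : T *m e = 0) (esT : es *m T = 0).
Hypotheses (esb : es *m b = 0) (ce : c *m e = 0).
Hypothesis tauE : tau = T + b *m es + e *m c + d *: (e *m es).

Lemma projH_e : P *m e = 0.
Proof. by rewrite PE mulmxBl mul1mx -mulmxA ese mulmx1 subrr. Qed.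

Lemma es_projH : es *m P = 0.
Proof. by rewrite PE mulmxBr mulmx1 mulmxA ese mul1mx subrr. Qed.

Lemma projH_id m (X : 'M[R]_(n, m)) : es *m X = 0 -> P *m X = X.
Proof. by move=> h; rewrite PE mulmxBl mul1mx -mulmxA h mulmx0 subr0. Qed.

Lemma id_projH m (X : 'M[R]_(m, n)) : X *m e = 0 -> X *m P = X.
Proof. by move=> h; rewrite PE mulmxBr mulmx1 mulmxA h mul0mx subr0. Qed.

Lemma block_tau_e : tau *m e = b + d *: e.
Proof.
rewrite tauE !mulmxDl Te -scalemxAl -!mulmxA ce ese.
by rewrite !mulmx1 mulmx0 add0r addr0.
Qed.

Lemma block_es_tau : es *m tau = c + d *: es.
Proof.
rewrite tauE !mulmxDr esT -scalemxAr !mulmxA esb ese.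
by rewrite !mul1mx mul0mx !add0r.
Qed.

Lemma block_col v : v = P *m v + dot es v *: e.
Proof.
rewrite PE mulmxBl mul1mx -[e *m es *m v]mulmxA dotE -scalemxAr mulmx1.
by rewrite subrK.
Qed.

Lemma block_row l : l = l *m P + dot l e *: es.
Proof. by rewrite PE mulmxBr mulmx1 mulmxA dotE -scalemxAl mul1mx subrK. Qed.

(* The bicommutant of T in End(V_H); since T is cyclic on V_H, this is R[T]. *)
Definition bicommutant (X : 'M[R]_n) : Prop :=
  [/\ X *m e = 0, es *m X = 0 &
      forall Z, Z *m e = 0 -> es *m Z = 0 -> Z *m T = T *m Z ->
        X *m Z = Z *m X].

Local Notation A := bicommutant.

Lemma bicommutant0 : A 0.
Proof. by split=> [||Z _ _ _]; rewrite ?mul0mx ?mulmx0. Qed.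

Lemma bicommutantT : A T.
Proof. by split=> [||Z _ _ ->]; rewrite ?Te ?esT. Qed.

Lemma bicommutantP : A P.
Proof.
split=> [||Z Ze esZ _]; rewrite ?projH_e ?es_projH //.
by rewrite projH_id // id_projH.
Qed.

Lemma bicommutantD X Y : A X -> A Y -> A (X + Y).
Proof.
move=> [Xe eX cX] [Ye eY cY]; split=> [||Z h1 h2 h3].
- by rewrite mulmxDl Xe Ye addr0.
- by rewrite mulmxDr eX eY addr0.
- by rewrite mulmxDl mulmxDr cX ?cY.
Qed.

Lemma bicommutantZ x X : A X -> A (x *: X).
Proof.
move=> [Xe eX cX]; split=> [||Z h1 h2 h3].
- by rewrite -scalemxAl Xe scaler0.
- by rewrite -scalemxAr eX scaler0.
- by rewrite -scalemxAl -scalemxAr cX.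
Qed.

Lemma bicommutantM X Y : A X -> A Y -> A (X *m Y).
Proof.
move=> [Xe eX cX] [Ye eY cY]; split=> [||Z h1 h2 h3].
- by rewrite -mulmxA Ye mulmx0.
- by rewrite mulmxA eX mul0mx.
- by rewrite -mulmxA cY // !mulmxA cX.
Qed.

(** Taking Z = T shows that [Y] commutes with [T], so [Y] is itself an admissible Z for [X]. *)
Lemma bicommutantC X Y : A X -> A Y -> X *m Y = Y *m X.
Proof.
move=> [_ _ cX] [Ye eY cY]; apply: cX => //.
by apply: cY; rewrite ?Te ?esT.
Qed.

Lemma bicommutant_tauX X : A X -> tau *m X = T *m X + e *m (c *m X).
Proof.
move=> [_ eX _]; rewrite tauE !mulmxDl -scalemxAl -!mulmxA eX !mulmx0.
by rewrite scaler0 !addr0.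
Qed.

Lemma bicommutant_Xtau X : A X -> X *m tau = X *m T + X *m b *m es.
Proof.
move=> [Xe _ _]; rewrite tauE !mulmxDr -scalemxAr !mulmxA Xe !mul0mx.
by rewrite scaler0 !addr0.
Qed.

(** Induction on i for u = tau^i e: if P u = X b, the block form of tau gives P tau u = (T X + x P)
    b with x the value of [es] at u. *)
Lemma block_cyclic_vec u : exists2 X, A X & P *m u = X *m b.
Proof.
move: u; apply: (cyclic_vec_ind cyc_e) => [|x u u' [X hX E] [X' hX' E']|i].
- by exists 0; [exact: bicommutant0 | rewrite mulmx0 mul0mx].
- exists (x *: X + X').
    by apply: bicommutantD => //; apply: bicommutantZ.
  by rewrite mulmxDr mulmxDl -scalemxAr -scalemxAl E E'.
elim: i => [|i [X hX E]].
  by exists 0; [exact: bicommutant0 | rewrite expr0 mul1mx projH_e mul0mx].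
rewrite exprS -mulmxA; move: (tau ^+ i *m e) E => u E.
exists (T *m X + dot es u *: P).
  apply: bicommutantD; last exact/bicommutantZ/bicommutantP.
  exact/bicommutantM/hX/bicommutantT.
rewrite {1}(block_col u) E mulmxDr -scalemxAr mulmxA bicommutant_tauX //.
rewrite block_tau_e !mulmxDl !mulmxDr -!scalemxAr !mulmxDr -!scalemxAr.
rewrite -[e *m _ *m _]mulmxA ![P *m (e *m _)]mulmxA projH_e mul0mx scaler0.
rewrite !addr0.
by rewrite -scalemxAl !projH_id // !mulmxA esT !mul0mx.
Qed.

(** The dual recursion: k tau P = c (X T + x P), with x the value of k at e. *)
Lemma block_cyclic_covec k : exists2 X, A X & k *m P = c *m X.
Proof.
move: k; apply: (cyclic_covec_ind cyc_es) => [|x u u' [X hX E] [X' hX' E']|i].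
- by exists 0; [exact: bicommutant0 | rewrite mulmx0 mul0mx].
- exists (x *: X + X').
    by apply: bicommutantD => //; apply: bicommutantZ.
  by rewrite mulmxDr mulmxDl -scalemxAr -scalemxAl E E'.
elim: i => [|i [X hX E]].
  by exists 0; [exact: bicommutant0 | rewrite expr0 mulmx1 es_projH mulmx0].
rewrite exprSr mulmxA; move: (es *m tau ^+ i) E => k E.
exists (X *m T + dot k e *: P).
  apply: bicommutantD; last exact/bicommutantZ/bicommutantP.
  exact/bicommutantM/bicommutantT.
rewrite {1}(block_row k) E mulmxDl -scalemxAl -mulmxA bicommutant_Xtau //.
rewrite block_es_tau !mulmxDr !mulmxDl -!scalemxAl !mulmxDl -!scalemxAl.
rewrite -!mulmxA es_projH !mulmx0 scaler0 !addr0.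
by rewrite -scalemxAr !id_projH.
Qed.

(* V_H^* = c A and V_H = A b, so A separates the vectors of V_H. *)
Lemma bicommutant_sep u :
  es *m u = 0 -> (forall X, A X -> dot (c *m X) u = 0) -> u = 0.
Proof.
move=> eu h; apply: dot_col_eq0 => k; have [X hX E] := block_cyclic_covec k.
by rewrite (block_row k) E dotDl dotZl h // (dot_eq0 eu) mulr0 addr0.
Qed.

Lemma bicommutant_cosep k :
  k *m e = 0 -> (forall X, A X -> dot k (X *m b) = 0) -> k = 0.
Proof.
move=> ke h; apply: dot_row_eq0 => u; have [X hX E] := block_cyclic_vec u.
by rewrite (block_col u) E dotDr dotZr h // (dot_eq0 ke) mulr0 addr0.
Qed.

(* The covector l = lam + s es and the vector v = w + t e are e^* a and a^-1 e;
   the first two orders of l y tau^i y^-1 v at y = 1 give H1 and H2. *)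
Section Rigidity.

Variables (lam : 'rV[R]_n) (w : 'cV[R]_n) (s t : R).
Hypotheses (lame : lam *m e = 0) (esw : es *m w = 0).
Local Notation l := (lam + s *: es).
Local Notation v := (w + t *: e).

Hypothesis double_inj : forall x : R, x + x = 0 -> x = 0.
Hypothesis H0 : forall i, dot l (tau ^+ i *m v) = dot es (tau ^+ i *m e).
Hypothesis H1 : forall X i, A X ->
  dot (l *m X) (tau ^+ i *m v) = dot l (tau ^+ i *m (X *m v)).
Hypothesis H2 : forall X i, A X ->
  dot l (tau ^+ i *m (X *m (X *m v))) = dot (l *m X) (tau ^+ i *m (X *m v)).

Local Notation phi X := (dot lam (X *m b)).
Local Notation psi X := (dot c (X *m w)).
Local Notation p := (dot lam b).
Local Notation q := (dot c w).

(** * Block computations with l, v and tau *)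

Lemma dot_es_e : dot es e = 1.
Proof. by rewrite /dot ese mxE eqxx. Qed.

Lemma dot_block k u x y : k *m e = 0 -> es *m u = 0 ->
  dot (k + x *: es) (u + y *: e) = dot k u + x * y.
Proof.
move=> ke eu; rewrite dotDl !dotDr !dotZl !dotZr (dot_eq0 ke) (dot_eq0 eu).
by rewrite dot_es_e; ring.
Qed.

Lemma dot_block0 k u x : es *m u = 0 -> dot (k + x *: es) u = dot k u.
Proof. by move=> eu; rewrite dotDl dotZl (dot_eq0 eu) mulr0 addr0. Qed.

Lemma bicommutant_col X : A X -> X *m v = X *m w.
Proof. by case=> Xe _ _; rewrite mulmxDr -scalemxAr Xe scaler0 addr0. Qed.

Lemma bicommutant_row X : A X -> l *m X = lam *m X.
Proof. by case=> _ eX _; rewrite mulmxDl -scalemxAl eX scaler0 addr0. Qed.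

Lemma tau_col X u : A X ->
  tau *m (X *m u) = T *m (X *m u) + dot c (X *m u) *: e.
Proof.
move=> hX; rewrite mulmxA bicommutant_tauX // mulmxDl -!mulmxA.
by rewrite (dotE c) -scalemxAr mulmx1.
Qed.

Lemma row_tau X k : A X -> k *m X *m tau = k *m X *m T + dot k (X *m b) *: es.
Proof.
move=> hX; rewrite -!mulmxA bicommutant_Xtau // mulmxDr !mulmxA.
by rewrite dotE -scalemxAl mul1mx dotA.
Qed.

Lemma tau_v : tau *m v = T *m w + t *: b + (q + t * d) *: e.
Proof.
rewrite -{1}(projH_id esw) mulmxDr tau_col ?projH_id //; last first.
  exact: bicommutantP.
rewrite -scalemxAr block_tau_e scalerDr scalerA scalerDl !addrA.
by congr (_ + _); rewrite addrAC.
Qed.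

Lemma l_tau : l *m tau = lam *m T + s *: c + (p + s * d) *: es.
Proof.
rewrite -{1}(id_projH lame) mulmxDl row_tau; last exact: bicommutantP.
rewrite id_projH // projH_id //.
rewrite -scalemxAl block_es_tau scalerDr scalerA scalerDl !addrA.
by congr (_ + _); rewrite addrAC.
Qed.

Lemma bicommutant_e X (k : 'rV[R]_n) : A X -> k *m X *m e = 0.
Proof. by case=> Xe _ _; rewrite -mulmxA Xe mulmx0. Qed.

Lemma es_bicommutant X (u : 'cV[R]_n) : A X -> es *m (X *m u) = 0.
Proof. by case=> _ eX _; rewrite mulmxA eX mul0mx. Qed.

Lemma bicommutant_CA X Y (u : 'cV[R]_n) :
  A X -> A Y -> X *m (Y *m u) = Y *m (X *m u).
Proof. by move=> hX hY; rewrite !mulmxA (bicommutantC hX). Qed.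

(** * Moments with i = 1 *)

Lemma l_X_tau X : A X -> l *m X *m tau = lam *m X *m T + phi X *: es.
Proof. by move=> hX; rewrite (bicommutant_row hX) (row_tau _ hX). Qed.

Lemma tau_X_v X : A X -> tau *m (X *m v) = T *m (X *m w) + psi X *: e.
Proof. by move=> hX; rewrite (bicommutant_col hX) (tau_col _ hX). Qed.

(** In [H1] with i = 1 the terms lam X T w and lam T X w cancel, leaving only the contributions of b
    and c. *)
Lemma moment1 X : A X -> s * psi X = t * phi X.
Proof.
move=> hX; have hT := bicommutantT.
have := H1 1%N hX; rewrite expr1 -dotA l_X_tau // tau_X_v //.
rewrite !dot_block ?bicommutant_e ?es_bicommutant // !dotA.
by rewrite (bicommutant_CA _ hX hT) => /addrI <-; ring.
Qed.

Lemma moment1_sq X : A X -> s * psi (X *m X) = 0.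
Proof.
move=> hX; have hT := bicommutantT; have hXX := bicommutantM hX hX.
have := H2 1%N hX; rewrite expr1 -[RHS]dotA l_X_tau //.
rewrite [X *m (X *m v)]mulmxA tau_X_v // (bicommutant_col hX).
rewrite dot_block ?es_bicommutant // dot_block0 ?es_bicommutant // !dotA.
rewrite -mulmxA !(bicommutant_CA _ hX hT) => E.
by apply: (addrI (dot lam (T *m (X *m (X *m w))))); rewrite E addr0.
Qed.

(** Polarization of [moment1_sq] in the commutative algebra A gives twice the claim. *)
Lemma s_psi X Y : A X -> A Y -> s * psi (X *m Y) = 0.
Proof.
move=> hX hY; apply: double_inj.
have := moment1_sq (bicommutantD hX hY).
rewrite mulmxDl !mulmxDr !mulmxDl !dotDr !mulrDr !moment1_sq //.
by rewrite (bicommutantC hY hX) add0r addr0.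
Qed.

(** Every c X with X in A kills s w, by [s_psi] with Y = P, and these covectors separate V_H. *)
Lemma sw0 : s *: w = 0.
Proof.
apply: bicommutant_sep => [|X hX]; first by rewrite -scalemxAr esw scaler0.
rewrite dotZr dotA -[RHS](s_psi hX bicommutantP).
by rewrite -mulmxA (projH_id esw).
Qed.

(** By [moment1] and [sw0], t lam vanishes on A b = V_H. *)
Lemma tlam0 : t *: lam = 0.
Proof.
apply: bicommutant_cosep => [|X hX]; first by rewrite -scalemxAl lame scaler0.
by rewrite dotZl -moment1 // -dotZr scalemxAr sw0 mulmx0 dot_eq0 ?mulmx0.
Qed.

(** * Moments with i = 2 *)

Lemma tau2 (u : 'cV[R]_n) : tau ^+ 2 *m u = tau *m (tau *m u).
Proof. by rewrite expr2 -mulmxA. Qed.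

Lemma dot_l_tau u x : es *m u = 0 -> s * dot c u = 0 ->
  dot (l *m tau) (u + x *: e) = dot lam (T *m u) + (p + s * d) * x.
Proof.
move=> eu scu; rewrite l_tau dot_block //; last first.
  by rewrite mulmxDl -mulmxA Te -scalemxAl ce mulmx0 scaler0 addr0.
by rewrite dotDl dotZl scu addr0 dotA.
Qed.

Lemma s_psi1 X : A X -> s * psi X = 0.
Proof. by move=> hX; rewrite -dotZr scalemxAr sw0 mulmx0 dot_eq0 ?mulmx0. Qed.

Lemma t_phi X : A X -> t * phi X = 0.
Proof. by move=> hX; rewrite -moment1 // s_psi1. Qed.

(** One factor tau goes to each side of the pairing in [H2]; the terms in T^2 cancel and those with
    a factor s psi vanish. *)
Lemma moment2_sq X : A X -> p * psi (X *m X) = phi X * psi X.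
Proof.
move=> hX; have hT := bicommutantT; have hXX := bicommutantM hX hX.
have := H2 2 hX; rewrite !tau2 -[RHS]dotA -[LHS]dotA l_X_tau //.
rewrite [X *m (X *m v)]mulmxA !tau_X_v // dot_l_tau ?es_bicommutant //;
  last first.
  by rewrite mulmxA s_psi1 //; apply: bicommutantM.
rewrite dot_block ?bicommutant_e ?es_bicommutant // !dotA.
rewrite -[X *m X *m w]mulmxA !(bicommutant_CA _ hX hT) => /addrI.
by rewrite mulrDl -mulrA [d * _]mulrC mulrA !mulmxA s_psi1 // mul0r addr0.
Qed.

(** The same splitting in [H1]; the terms with a factor t phi or s psi vanish. *)
Lemma moment2 X : A X -> phi X * q = p * psi X.
Proof.
move=> hX; have hT := bicommutantT.
have := H1 2 hX; rewrite !tau2 -[LHS]dotA -[RHS]dotA l_X_tau //.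
rewrite tau_X_v // dot_l_tau ?es_bicommutant //; last first.
  by rewrite mulmxA s_psi1 //; apply: bicommutantM.
rewrite tau_v dot_block ?bicommutant_e //; last first.
  by rewrite mulmxDr mulmxA esT mul0mx add0r -scalemxAr esb scaler0.
rewrite !dotA mulmxDr -scalemxAr mulmxDr -scalemxAr !dotDr !dotZr.
rewrite !(bicommutant_CA _ hX hT) [T *m (X *m b)]mulmxA.
rewrite (t_phi (bicommutantM hT hX)) addr0 => /addrI.
rewrite mulrDr mulrCA [phi X * _]mulrC.
rewrite [t * _]mulrA t_phi // mul0r addr0 mulrDl mulrAC s_psi1 // mul0r.
by rewrite addr0.
Qed.

(** * The idempotent f = 1 - s t and its vanishing *)

Local Notation f := (dot lam w).

Lemma f_add_st : f + s * t = 1.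
Proof. by have := H0 0; rewrite expr0 !mul1mx dot_es_e dot_block. Qed.

Lemma s_f : s * f = 0.
Proof. by rewrite -dotZr sw0 dot_eq0 ?mulmx0. Qed.

Lemma f_id x : s * x = 0 -> f * x = x.
Proof.
move=> sx; have -> : f = 1 - s * t by rewrite -f_add_st addrK.
by rewrite mulrBl mul1r mulrAC sx mul0r subr0.
Qed.

Lemma f_w : f *: w = w.
Proof.
have -> : f = 1 - t * s by rewrite -f_add_st mulrC addrK.
by rewrite scalerBl scale1r -scalerA sw0 scaler0 subr0.
Qed.

Lemma f_lam : f *: lam = lam.
Proof.
have -> : f = 1 - s * t by rewrite -f_add_st addrK.
by rewrite scalerBl scale1r -scalerA tlam0 scaler0 subr0.
Qed.

Lemma f_p : f * p = p. Proof. by rewrite -dotZl f_lam. Qed.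

Lemma lam_cyclic : exists2 L, A L & lam = c *m L.
Proof.
by have [L hL E] := block_cyclic_covec lam; exists L; rewrite // -E id_projH.
Qed.

Lemma w_cyclic : exists2 W, A W & w = W *m b.
Proof.
by have [W hW E] := block_cyclic_vec w; exists W; rewrite // -E projH_id.
Qed.

Lemma psi_polar X Y : A X -> A Y ->
  p * psi (X *m Y) + p * psi (X *m Y) = phi X * psi Y + phi Y * psi X.
Proof.
move=> hX hY; have := moment2_sq (bicommutantD hX hY).
rewrite mulmxDl !mulmxDr !mulmxDl !dotDr !mulrDr !mulrDl !moment2_sq //.
rewrite (bicommutantC hY hX) => E.
apply: (addrI (phi X * psi X)); apply: (addIr (phi Y * psi Y)).
by rewrite addrA -[LHS]addrA E; ring.
Qed.

(** On the component where f = 1, p is invertible. *)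
Lemma p_unit : exists p', p * p' = f.
Proof.
have [L hL EL] := lam_cyclic; have [W hW EW] := w_cyclic.
have psiL : psi L = f by rewrite -dotA -EL.
have phiW : phi W = f by rewrite -EW.
(* By [psi_polar] and [moment2_sq], p times this is phi W (phi W psi L + phi L psi W) - phi L phi W
   psi W. The mixed terms cancel, leaving f^3 = f. *)
exists (phi W * psi (W *m L) + phi W * psi (W *m L) - phi L * psi (W *m W)).
have ff : f * f = f by rewrite f_id ?s_f.
rewrite mulrBr mulrDr ![p * (phi W * _)]mulrCA -mulrDr psi_polar //.
rewrite [p * (phi L * _)]mulrCA moment2_sq // psiL phiW ff; ring: ff.
Qed.

(** After multiplication by p, [moment2] turns both terms of [psi_polar] into q phi X phi Y, so they
    agree; then 2 and p are cancelled, p by means of [p_unit]. *)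
Lemma psiM X Y : A X -> A Y -> p * psi (X *m Y) = phi X * psi Y.
Proof.
move=> hX hY; have hXY := bicommutantM hX hY; have [p' pp'] := p_unit.
have E : p * (p * psi (X *m Y)) = p * (phi X * psi Y).
  apply/eqP; rewrite -subr_eq0; apply/eqP/double_inj.
  rewrite addrACA -mulrDr psi_polar // -opprD.
  rewrite mulrDr ![p * (_ * psi _)]mulrCA -!moment2 //; ring.
have := congr1 ( *%R p') E; rewrite !mulrA [p' * p]mulrC pp' f_p.
by rewrite -[f * dot lam _]dotZl f_lam.
Qed.

Lemma T_w : T *m w = d *: w.
Proof.
have hT := bicommutantT; have [p' pp'] := p_unit.
(* By [psiM] with first factor T, each c X takes the same value on both sides. *)
have Ew : T *m w = (p' * phi T) *: w.
  apply/eqP; rewrite -subr_eq0; apply/eqP; apply: bicommutant_sep => [|X hX].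
    by rewrite mulmxBr mulmxA esT mul0mx -scalemxAr esw scaler0 subrr.
  rewrite dotDr dotNr dotZr !dotA (bicommutant_CA _ hX hT) -mulrA -psiM //.
  rewrite mulrA [p' * p]mulrC pp' -mulmxA f_id ?subrr //.
  by rewrite mulmxA s_psi1 //; apply: bicommutantM.
(* The moment [H0] with i = 1 identifies the eigenvalue with d, up to the factor f. *)
have E1 : dot lam (T *m w) = d * f.
  have := H0 1%N; rewrite expr1 -dotA dot_l_tau //; last first.
    by rewrite -dotZr sw0 dot_eq0 ?mulmx0.
  rewrite block_tau_e dotDr dotZr (dot_eq0 esb) dot_es_e add0r mulr1 => E.
  have tp : t * p = 0 by rewrite -dotZl tlam0 dot_eq0 ?mul0mx.
  apply: (addIr ((p + s * d) * t)); rewrite E -[LHS]mulr1 -f_add_st.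
  by rewrite [(_ + _) * t]mulrDl [p * t]mulrC tp; ring.
rewrite Ew dotZr in E1.
have := congr1 ( *:%R^~ w) E1.
by rewrite /= -[(d * f) *: w]scalerA -[(_ * f) *: w]scalerA f_w Ew.
Qed.

(** Since f l = lam and t lam = 0, [H0] gives f e^* tau^j e = lam tau^j w. For j = i + 1, expanding
    e^* tau on the left and tau w = d w + q e on the right gives the claim on tau^i e. *)
Lemma f_c : f *: c = q *: lam.
Proof.
suff E u : dot (f *: c - q *: lam) u = 0.
  by apply/eqP; rewrite -subr_eq0; apply/eqP; apply: dot_row_eq0.
move: u; apply: (cyclic_vec_ind cyc_e) => [|x u u' E E'|i].
- by rewrite dot_eq0 ?mulmx0.
- by rewrite dotDr dotZr E E' mulr0 addr0.
have m j : f * dot es (tau ^+ j *m e) = dot lam (tau ^+ j *m w).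
  rewrite -H0 -dotZl scalerDr f_lam scalerA mulrC s_f scale0r addr0.
  rewrite !mulmxDr -scalemxAr dotDr dotZr -dotZl tlam0.
  by rewrite [dot 0 _]dot_eq0 ?mul0mx ?addr0.
have tw : tau *m w = d *: w + q *: e.
  by rewrite -{1}(projH_id esw) tau_col ?projH_id // ?T_w //; exact: bicommutantP.
have := m i.+1; rewrite {1}exprS exprSr -!mulmxA tw mulmxDr.
rewrite -!scalemxAr dotDr !dotZr -m -dotA block_es_tau dotDl dotZl.
rewrite dotDl dotNl !dotZl.
move=> E; apply: (addIr (q * dot lam (tau ^+ i *m e))).
rewrite subrK add0r.
by apply: (addrI (d * (f * dot es (tau ^+ i *m e)))); rewrite -E; ring.
Qed.

(** The key identity is f P = (L b)(c W), of rank at most one. Adding f e e^* factors f times the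
    identity of V through R^2. *)
Lemma rigidity : (3 <= n)%N -> lam = 0 /\ w = 0.
Proof.
move=> n3; suff f0 : f = 0.
  by split; [rewrite -f_lam | rewrite -f_w]; rewrite f0 scale0r.
have [L hL EL] := lam_cyclic; have [W hW EW] := w_cyclic.
have ff : f * f = f by rewrite f_id ?s_f.
apply: (@idem_rank1 _ _ _ (L *m b) (f *: e) (c *m W) es n3 ff).
have -> : f%:M = f *: P + f *: e *m es.
  by rewrite -scalemxAl -scalerDr PE subrK scalemx1.
(* The identity is tested between a covector k and the vectors Y b, which exhaust V_H. *)
congr (_ + _); apply/row_matrixP => i; rewrite !rowE; move: (delta_mx 0 i) => k.
apply/eqP; rewrite -subr_eq0; apply/eqP; apply: bicommutant_cosep => [|Y hY].
  rewrite mulmxBl -scalemxAr -scalemxAl -!mulmxA projH_e.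
  by case: hW => -> _ _; rewrite !mulmx0 scaler0 subrr.
have [X hX EX] := block_cyclic_covec k.
have kLb : dot k (L *m b) = phi X.
  rewrite EL dotA [L *m (X *m b)]mulmxA (bicommutantC hL hX) -mulmxA.
  rewrite -[dot c _]dotA -EX.
  by rewrite dotA projH_id // es_bicommutant.
(* With k P = c X and f c = q lam, it becomes q phi (X Y) = phi X psi Y, which is [moment2] combined
   with [psiM]. *)
rewrite dotDl dotNl -scalemxAr dotZl EX mulmxA (dotE k) kLb -scalemxAl mul1mx.
rewrite dotZl !dotA (bicommutant_CA _ hW hY) -EW -psiM //.
rewrite -dotZl f_c dotZl [X *m (Y *m b)]mulmxA mulrC moment2 ?subrr //.
exact: bicommutantM.
Qed.

End Rigidity.

End Blocks.

(** * Conjugation by 1 + x Y modulo x^3 *)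

Lemma dot_map (R R' : comPzRingType) (F : {rmorphism R -> R'}) n
    (k : 'rV[R]_n) (u : 'cV[R]_n) :
  dot (map_mx F k) (map_mx F u) = F (dot k u).
Proof. by rewrite /dot -map_mxM mxE. Qed.

(** The geometric series for the inverse of 1 + x Y stops after the quadratic term. *)
Lemma mulmx_order3_inv (R : comPzRingType) n (Y : 'M[R]_n) (x : R)
    (y := 1%:M + x *: Y) (y' := 1%:M - x *: Y + x ^+ 2 *: (Y *m Y)) :
  x ^+ 3 = 0 -> y *m y' = 1%:M /\ y' *m y = 1%:M.
Proof.
move=> x3; split.
  rewrite /y /y' mulmxDl mul1mx mulmxDr mulmxBr mulmx1 -!scalemxAl -!scalemxAr.
  rewrite !scalerA -expr2 -exprS x3 scale0r addr0 addrAC addrA addrAC.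
  by rewrite subrK addrK.
rewrite /y mulmxDr mulmx1 -scalemxAr /y' mulmxDl mulmxBl mul1mx -!scalemxAl.
rewrite scalerDr scalerBr !scalerA -expr2 -exprS x3 scale0r addr0.
by rewrite addrACA subrK subrr addr0.
Qed.

(** The coefficients of x and x^2 come from Y N - N Y and N Y^2 - Y N Y; their vanishing is the form
    of [H1] and [H2]. *)
Lemma dot_conj_order2 (R : comPzRingType) n (k : 'rV[R]_n) (u : 'cV[R]_n)
    (Y N : 'M[R]_n) (x : R) : x ^+ 3 = 0 ->
  dot k ((1%:M + x *: Y) *m N *m (1%:M - x *: Y + x ^+ 2 *: (Y *m Y)) *m u)
  = dot k (N *m u) + x * (dot (k *m Y) (N *m u) - dot k (N *m (Y *m u)))
    + x ^+ 2 * (dot k (N *m (Y *m (Y *m u))) - dot (k *m Y) (N *m (Y *m u))).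
Proof.
move=> x3.
rewrite -!mulmxA [(_ - _ + _) *m u]mulmxDl mulmxBl mul1mx -!scalemxAl -mulmxA.
rewrite mulmxDl mul1mx -scalemxAl !mulmxDr !mulmxN -!scalemxAr.
rewrite !(dotDr, dotNr, dotZr) !dotA.
ring: x3.
Qed.

(** * From points of X to identities between moments *)

Section Descent.

Variables (n : nat) (e : 'cV[int]_n) (es : 'rV[int]_n).
Variables (R : comPzRingType) (tau a a' : 'M[R]_n).
Hypothesis a'a : a' *m a = 1%:M.

Lemma map_vecR (R' : comPzRingType) (F : {rmorphism R -> R'}) :
  map_mx F (vecR e R) = vecR e R'.
Proof. by rewrite -map_mx_comp; apply: eq_map_mx => x; rewrite /= rmorph_int. Qed.

Lemma map_covecR (R' : comPzRingType) (F : {rmorphism R -> R'}) :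
  map_mx F (covecR es R) = covecR es R'.
Proof. by rewrite -map_mx_comp; apply: eq_map_mx => x; rewrite /= rmorph_int. Qed.

(** Writing a y = h g turns the left side into e^* h g tau^i g^-1 h^-1 e. Here g commutes with tau,
    and h fixes e and e^*. *)
Lemma moments_conj (R' : comPzRingType) (F : {rmorphism R -> R'})
    (y y' : 'M[R']_n) i :
  y *m y' = 1%:M -> y' *m y = 1%:M ->
  in_mulset (inH e es (R := R')) (inG_cent (map_mx F tau)) (map_mx F a *m y) ->
  dot (map_mx F (covecR es R *m a))
    (y *m map_mx F (tau ^+ i) *m y' *m map_mx F (a' *m vecR e R))
  = F (dot (covecR es R) (tau ^+ i *m vecR e R)).
Proof.
move=> yy' y'y [h [g [[[h' [hh' h'h]] he esh] [[g' [gg' g'g]] gt] E]]].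
change (h *m h' = 1%:M) in hh'; change (h' *m h = 1%:M) in h'h.
change (g *m g' = 1%:M) in gg'.
(* Both sides are inverse to a y = h g. *)
have E' : y' *m map_mx F a' = g' *m h'.
  have E1 : map_mx F a *m y *m (g' *m h') = 1%:M.
    by rewrite E -mulmxA [g *m _]mulmxA gg' mul1mx.
  have E2 : y' *m map_mx F a' *m (map_mx F a *m y) = 1%:M.
    rewrite -mulmxA [map_mx F a' *m _]mulmxA -(map_mxM F) a'a map_mx1 mul1mx.
    exact: y'y.
  by rewrite -[LHS]mulmx1 -E1 mulmxA E2 mul1mx.
have h'e : h' *m vecR e R' = vecR e R' by rewrite -{1}he mulmxA h'h mul1mx.
rewrite -dot_map !map_mxM map_vecR map_covecR /dot; congr fun_of_matrix.
rewrite !mulmxA -[_ *m y' *m _]mulmxA E' -[_ *m map_mx F a *m y]mulmxA E.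
have gti : g *m map_mx F (tau ^+ i) = map_mx F (tau ^+ i) *m g.
  have -> : map_mx F (tau ^+ i) = map_mx F tau ^+ i.
    by elim: i => [|i IH]; [exact: map_mx1 | rewrite !exprS -IH; exact: map_mxM].
  exact: commrX.
rewrite [covecR es R' *m (h *m g)]mulmxA esh -[_ *m g *m _]mulmxA gti !mulmxA.
rewrite -[_ *m g *m g']mulmxA gg' mulmx1.
by rewrite -[_ *m h' *m _]mulmxA h'e.
Qed.

Hypothesis hX : forall (R' : comPzRingType) (F : {rmorphism R -> R'})
  (y : 'M[R']_n), inX e es F tau a y <-> inH_tauH e es F tau y.

Local Notation E := (vecR e R).
Local Notation ES := (covecR es R).

(** The point y = 1 over R itself. *)
Lemma moments0 i :
  dot (ES *m a) (tau ^+ i *m (a' *m E)) = dot ES (tau ^+ i *m E).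
Proof.
have h1 : inH_tauH e es (@idfun R : {rmorphism R -> R}) tau 1%:M.
  split; last by rewrite mulmx1 mul1mx.
  by split; rewrite ?mulmx1 ?mul1mx //; exists 1%:M; split; exact: mulmx1.
have [_ /(moments_conj i (mulmx1 _) (mulmx1 _))] := (hX _ _).2 h1.
by rewrite !map_mx_id // mulmx1 mul1mx.
Qed.

(** The point y = 1 + eps X over R[eps]/(eps^3). Its moments are constants from R, so their
    coefficients at eps and eps^2 vanish. *)
Lemma moments12 X i : X *m E = 0 -> ES *m X = 0 ->
  X *m compress_H e es tau = compress_H e es tau *m X ->
  dot (ES *m a *m X) (tau ^+ i *m (a' *m E))
    = dot (ES *m a) (tau ^+ i *m (X *m (a' *m E))) /\
  dot (ES *m a) (tau ^+ i *m (X *m (X *m (a' *m E))))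
    = dot (ES *m a *m X) (tau ^+ i *m (X *m (a' *m E))).
Proof.
move=> XE EX XT; pose F : {rmorphism R -> trunc3 R} := @trunc3_const R.
pose x := trunc3_eps R; pose Y := map_mx F X.
pose y := 1%:M + x *: Y; pose y' := 1%:M - x *: Y + x ^+ 2 *: (Y *m Y).
have x3 : x ^+ 3 = 0 by exact: trunc3_eps3.
have [yy' y'y] : y *m y' = 1%:M /\ y' *m y = 1%:M := mulmx_order3_inv Y x3.
have hy : inH_tauH e es F tau y.
  have YE : Y *m vecR e _ = 0 by rewrite -(map_vecR F) -map_mxM XE map_mx0.
  have EY : covecR es _ *m Y = 0 by rewrite -(map_covecR F) -map_mxM EX map_mx0.
  split.
    split; first by exists y'; split; [exact: yy' | exact: y'y].
      by rewrite mulmxDl mul1mx -scalemxAl YE scaler0 addr0.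
    by rewrite mulmxDr mulmx1 -scalemxAr EY scaler0 addr0.
  by rewrite mulmxDl mulmxDr mul1mx mulmx1 -scalemxAl -scalemxAr -!map_mxM XT.
have [_ /(moments_conj i yy' y'y)] := (hX _ _).2 hy.
rewrite (dot_conj_order2 _ _ _ _ x3) -!map_mxM !dot_map -!rmorphB.
move=> /trunc3_coef[h1 h2].
by split; apply/eqP; rewrite -subr_eq0; apply/eqP.
Qed.

End Descent.

(** * Application of rigidity to e^* a and a^-1 e *)

Theorem theorem5p1 (n : nat) (e : 'cV[int]_n) (es : 'rV[int]_n)
    (hes : es *m e = 1%:M) (hn : (3 <= n)%N)
    (R : comPzRingType) (h2 : invertible (2%:R : R))
    (tau a : 'M[R]_n) (htau : stable e es tau) (ha : inG a)
    (hX : forall (R' : comPzRingType) (f : {rmorphism R -> R'}) (y : 'M[R']_n),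
        inX e es f tau a y <-> inH_tauH e es f tau y) :
  in_mulset (inH e es (R := R)) (@inZ n R) a.
Proof.
have [a' [aa' a'a]] : invertible a := ha.
have {}aa' : a *m a' = 1%:M by exact: aa'.
have {}a'a : a' *m a = 1%:M by exact: a'a.
have [cyc_e cyc_es] := htau.
set E := vecR e R in cyc_e *; set ES := covecR es R in cyc_es *.
have ese : ES *m E = 1%:M by rewrite -map_mxM hes map_mx1.
set P := proj_H e es R; set T := compress_H e es tau.
have PE : P = 1%:M - E *m ES by [].
have Pe := projH_e ese PE; have eP := es_projH ese PE.
have Te : T *m E = 0 by rewrite -mulmxA Pe mulmx0.
have eT : ES *m T = 0 by rewrite !mulmxA eP !mul0mx.
pose b := P *m tau *m E; pose c := ES *m tau *m P; pose d := dot ES (tau *m E).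
have eb : ES *m b = 0 by rewrite !mulmxA eP !mul0mx.
have ce : c *m E = 0 by rewrite -mulmxA Pe mulmx0.
have tauE : tau = T + b *m ES + E *m c + d *: (E *m ES).
  have -> : d *: (E *m ES) = E *m ES *m tau *m (E *m ES).
    by rewrite -!mulmxA [tau *m (E *m ES)]mulmxA [ES *m (_ *m ES)]mulmxA dotE
               -scalemxAl mul1mx -scalemxAr.
  (* The four blocks come from inserting 1 = P + e e^* on both sides of tau. *)
  have {1}-> : tau = (P + E *m ES) *m tau *m (P + E *m ES).
    by rewrite PE subrK mul1mx mulmx1.
  rewrite /T /compress_H -/P /b /c; move: P {PE Pe eP T Te eT b c eb ce} => p.
  by rewrite mulmxDr !mulmxDl !mulmxA addrA; congr (_ + _); rewrite addrAC.
pose l := ES *m a; pose v := a' *m E; pose s := dot l E; pose t := dot ES v.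
have lE : l = l *m P + s *: ES := block_row PE l.
have vE : v = P *m v + t *: E := block_col PE v.
have [lam0 w0] : l *m P = 0 /\ P *m v = 0.
  apply: (rigidity ese cyc_e cyc_es PE Te eT eb ce tauE (s := s) (t := t)) => //.
  - by rewrite -mulmxA Pe mulmx0.
  - by rewrite mulmxA eP mul0mx.
  - have [x2 [_ h]] := h2 => x xx.
    by rewrite -[x]mul1r -h -mulrA mulr_natl mulr2n xx mulr0.
  - by move=> i; rewrite -lE -vE; exact: moments0 a'a hX i.
  (* The choice Z = T in the bicommutant condition shows that X commutes with tau_H. *)
  - move=> X i [XE EX XT]; rewrite -lE -vE.
    by have [] := moments12 a'a hX i XE EX (XT T Te eT erefl).
  - move=> X i [XE EX XT]; rewrite -lE -vE.
    by have [] := moments12 a'a hX i XE EX (XT T Te eT erefl).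
rewrite lam0 add0r in lE; rewrite w0 add0r in vE.
have st : s * t = 1.
  have : dot l v = 1 by rewrite /l /v dotA [a *m _]mulmxA aa' mul1mx (dot_es_e ese).
  by rewrite lE vE dotZl dotZr (dot_es_e ese) mulr1.
have ts : t * s = 1 by rewrite mulrC.
have aE : a *m E = s *: E.
  have av : a *m v = E by rewrite mulmxA aa' mul1mx.
  by rewrite -{2}av vE -scalemxAr scalerA st scale1r.
(* Now a e = s e and e^* a = s e^* with s t = 1, so t a fixes both e and e^*. *)
exists (t *: a), s%:M; split.
- split.
  + exists (s *: a'); split; rewrite -[LHS]/(_ *m _) -scalemxAl -scalemxAr scalerA.
      by rewrite ts scale1r aa'.
    by rewrite st scale1r a'a.
  + by rewrite -scalemxAl aE scalerA ts scale1r.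
  + by rewrite -scalemxAr -/l lE scalerA ts scale1r.
- by exists s => //; exists t.
- by rewrite mul_mx_scalar scalerA st scale1r.
Qed.
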